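(* Let $n$ be a positive integer and for integers $k\ge 0$ and $0\le j\le n$ let \[ c_{n,k}(j)=\sum_{i=0}^{k}(-1)^i(k+1-i)^{n-j}(k-i)^j\binom{n+1}{i} \] (with the convention $0^0=1$). Then: 1. $\sum_{k=0}^n c_{n,k}(j)=n!$ for every $0\le j\le n$; 2. $c_{n,k}(j)=c_{n,n-k}(n-j)$ for all $0\le j,k\le n$.
   Context: The numbers $c_{n,k}(j)$ are the coefficients in the expansion $\sum_{i=0}^{k}(-1)^i[(k+1-i)d-a]^n\binom{n+1}{i}=\sum_{j=0}^n c_{n,k}(j)\binom{n}{j}(d-a)^{n-j}a^j$ of the general Eulerian numbers $A_{n,k}(a,d)$. *)

(* Defs.v *)
From HB Require Import structures.
From mathcomp Require Import all_boot all_order all_algebra.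

Set Implicit Arguments.
Unset Strict Implicit.
Unset Printing Implicit Defensive.

Import Order.TTheory GRing.Theory Num.Theory.

Local Open Scope ring_scope.

(* The number c_{n,k}(j). The exponent n - j is truncated subtraction on nat,  *)
(* so the definition is meaningful only for j <= n. Since x ^+ 0 = 1 for every *)
(* x, the term i = k follows the convention 0 ^ 0 = 1 when j = 0.              *)
Definition eulerian_coef (n k j : nat) : int :=
  \sum_(0 <= i < k.+1)
    (-1) ^+ i * (k%:Z + 1 - i%:Z) ^+ (n - j) * (k%:Z - i%:Z) ^+ j
    * ('C(n.+1, i))%:Z.

(* Main.v *)
Require Import Defs.
From HB Require Import structures.
From mathcomp Require Import all_boot all_order all_algebra.
From mathcomp Require Import ring.

Set Implicit Arguments.
Unset Strict Implicit.
Unset Printing Implicit Defensive.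

Import Order.TTheory GRing.Theory Num.Theory.

Local Open Scope ring_scope.

(** Put p = (X + 1)^(n-j) X^j, which is monic of degree n, so that c_{n,k}(j)
    is the (n+1)-st backward difference of p at k truncated after the term
    i = k.  By Pascal's rule this is S_k - S_(k-1), where S_k is the n-th
    backward difference truncated in the same way; the sum over k telescopes
    to S_n, a complete n-th difference, equal to n!.  The complete (n+1)-st
    difference vanishes, so c_{n,k}(j) is also minus the sum over i > k, and
    i |-> n + 1 - i turns that into c_{n,n-k}(n-j). *)

Section BackwardDifference.

Variable R : comNzRingType.
Implicit Types (f : R -> R) (p : {poly R}) (x : R).

Definition trunc_diff n k f x : R :=
  \sum_(0 <= i < k.+1) (-1) ^+ i * f (x - i%:R) *+ 'C(n, i).

Definition diff n f x : R := trunc_diff n n f x.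

(** In the term of index [i.+1], Pascal's rule leaves a part with ['C(n, i)]; its extra sign and its
    shift by one give the subtracted difference at [x - 1]. *)
Lemma trunc_diff_pascal n k f x :
  trunc_diff n.+1 k.+1 f x = trunc_diff n k.+1 f x - trunc_diff n k f (x - 1).
Proof.
rewrite /trunc_diff (big_nat_recl k.+1) // (big_nat_recl k.+1) // !bin0 -addrA; congr (_ + _).
rewrite -sumrB; apply: eq_bigr => i _.
have -> : x - 1 - i%:R = x - i.+1%:R by rewrite -natr1; ring.
by rewrite binS exprS; move: (f _) 'C(n, i.+1) 'C(n, i) => y a b; ring.
Qed.

(** Evaluating at [l%:R] makes the shift to [x - 1] agree with lowering the truncation index, so the
    Pascal recursion telescopes. *)
Lemma sum_trunc_diff n f k :
  \sum_(0 <= l < k.+1) trunc_diff n.+1 l f l%:R = trunc_diff n k f k%:R.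
Proof.
elim: k => [|k IHk].
  by rewrite /trunc_diff !big_nat1 !bin0.
by rewrite big_nat_recr //= IHk trunc_diff_pascal -natr1 addrK addrC subrK.
Qed.

(** This is [c] times the binomial expansion of [(1 - 1) ^+ n.+1]. *)
Lemma diff_const n c x : diff n.+1 (fun=> c) x = 0.
Proof.
rewrite /diff /trunc_diff big_mkord.
have := exprBn (1 : R) 1 n.+1; rewrite subrr expr0n /= => /(congr1 ( *%R^~ c)).
rewrite mul0r mulr_suml => H; rewrite [RHS]H {H}; apply: eq_bigr => i _.
by rewrite !expr1n !mulr1 mulrnAl.
Qed.

(** A Leibniz rule: split the factor [x - i%:R] and absorb [i] through
    [i * 'C(n.+1, i) = n.+1 * 'C(n, i.-1)]. *)
Lemma diff_mulX n f x :
  diff n.+1 (fun y => f y * y) x = x * diff n.+1 f x + diff n f (x - 1) *+ n.+1.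
Proof.
rewrite /diff /trunc_diff mulr_sumr (big_nat_recl n.+1) // (big_nat_recl n.+1) // -addrA.
rewrite -sumrMnl -big_split /=; congr (_ + _).
  by rewrite !bin0 !expr0 subr0 !mulr1n !mul1r mulrC.
apply: eq_bigr => i _.
have -> : x - 1 - i%:R = x - i.+1%:R by rewrite -natr1; ring.
rewrite -[in RHS]mulrnA [('C(n, i) * _)%N]mulnC mul_bin_diag.
by rewrite exprS; move: (f _) 'C(n.+1, i.+1) => y a; ring.
Qed.

Lemma diff_poly n p x :
  (size p <= n.+1)%N -> diff n (horner p) x = p`_n *+ n`!.
Proof.
elim/poly_ind: p n x => [|p c IHp] n x.
  move=> _; rewrite coef0 mul0rn /diff /trunc_diff big1 // => i _.
  by rewrite horner0 mulr0 mul0rn.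
rewrite size_MXaddC.
case: n => [|n] size_p.
  have -> : p = 0.
    apply: contraTeq size_p => p_neq0.
    by rewrite (negPf p_neq0) ltnS leqn0 size_poly_eq0.
  by rewrite /diff /trunc_diff big_nat1 mul0r add0r hornerC coefC expr0 mul1r bin0 fact0.
have {}size_p : (size p <= n.+1)%N.
  by move: size_p; case: eqP => [->|_] /=; rewrite ?size_poly0.
have -> : diff n.+1 (horner (p * 'X + c%:P)) x =
    diff n.+1 (fun y => p.[y] * y) x + diff n.+1 (fun=> c) x.
  rewrite /diff /trunc_diff -big_split /=; apply: eq_bigr => i _.
  by rewrite hornerMXaddC mulrDr mulrnDl.
(* The induction hypothesis serves at orders [n.+1] and [n]; at order [n.+1] it gives zero, as [p]
   has degree at most [n]. *)
rewrite diff_const addr0 diff_mulX !IHp ?(leqW size_p) //.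
rewrite coefD coefMX coefC /= addr0 (nth_default _ size_p) mul0rn mulr0 add0r.
by rewrite -mulrnA mulnC -factS.
Qed.

End BackwardDifference.

Definition eulerian_poly (n j : nat) : {poly int} := ('X + 1) ^+ (n - j) * 'X^j.

Lemma horner_eulerian_poly n j (x : int) :
  (eulerian_poly n j).[x] = (x + 1) ^+ (n - j) * x ^+ j.
Proof. by rewrite /eulerian_poly !hornerE. Qed.

Lemma eulerian_poly_monic n j : eulerian_poly n j \is monic.
Proof. by rewrite rpredM ?monicXn // rpredX // -polyC1 monicXaddC. Qed.

Lemma size_eulerian_poly n j : (j <= n)%N -> size (eulerian_poly n j) = n.+1.
Proof.
move=> le_jn; rewrite /eulerian_poly size_Mmonic ?monicXn //.
  by rewrite size_polyXn addnS /= -polyC1 -[1]opprK polyCN size_exp_XsubC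
    addSn subnK.
by rewrite monic_neq0 // rpredX // -polyC1 monicXaddC.
Qed.

Lemma eulerian_coefE n k j :
  eulerian_coef n k j = trunc_diff n.+1 k (horner (eulerian_poly n j)) k%:R.
Proof.
apply: eq_bigr => i _.
rewrite horner_eulerian_poly -mulr_natr !natz mulrA.
by rewrite addrAC.
Qed.

Lemma sum_eulerian_coef n j : (j <= n)%N ->
  \sum_(0 <= k < n.+1) eulerian_coef n k j = (n`!)%:Z.
Proof.
move=> le_jn; under eq_bigr do rewrite eulerian_coefE.
rewrite sum_trunc_diff -/(diff _ _ _) diff_poly ?size_eulerian_poly //.
have /monicP := eulerian_poly_monic n j.
by rewrite lead_coefE size_eulerian_poly //= => ->; rewrite natz.
Qed.

Lemma eulerian_coef_sym n j k : (j <= n)%N -> (k <= n)%N ->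
  eulerian_coef n k j = eulerian_coef n (n - k) (n - j).
Proof.
move=> le_jn le_kn; rewrite eulerian_coefE.
have: diff n.+1 (horner (eulerian_poly n j)) k%:R = 0.
  rewrite diff_poly ?size_eulerian_poly //.
  by rewrite nth_default ?mul0rn // size_eulerian_poly.
rewrite /diff {1}/trunc_diff (@big_cat_nat _ _ _ k.+1) //=; last first.
  by rewrite ltnS leqW.
move/eqP; rewrite addr_eq0 => /eqP; rewrite /trunc_diff => ->.
rewrite big_nat_rev /= -{1}[k.+1]add0n big_addn.
have -> : (n.+2 - k.+1 = (n - k).+1)%N by rewrite subSS subSn.
rewrite /eulerian_coef -sumrN; apply: eq_big_nat => i /andP[_].
rewrite ltnS => le_i.
have le_in : (i <= n.+1)%N by rewrite (leq_trans le_i) // leqW // leq_subr.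
have -> : (k.+1 + n.+2 - (i + k.+1).+1 = n.+1 - i)%N.
  by rewrite -addnS addnC addSnnS subnDr.
rewrite bin_sub // horner_eulerian_poly subKn // -mulr_natr.
rewrite natrB // !natz -!subzn //.
(* Up to sign, the reflection exchanges the two bases, which is why [j] becomes [n - j]. *)
have -> : k%:Z - (n.+1%:Z - i%:Z) + 1 = - (n%:Z - k%:Z - i%:Z).
  by rewrite intS; ring.
have -> : k%:Z - (n.+1%:Z - i%:Z) = - (n%:Z - k%:Z + 1 - i%:Z).
  by rewrite intS; ring.
(* The exponents add up to [2n + 1 - i], of parity opposite to [i]; this cancels the minus sign from
   passing to the complementary sum. *)
have sign_eq : (-1) ^+ (n.+1 - i) * (-1) ^+ (n - j) * (-1) ^+ j = - (-1) ^+ i :> int.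
  rewrite -mulrA -exprD subnK // -exprD -signr_odd -[in RHS]signr_odd.
  by rewrite oddD oddB //=; case: (odd n) (odd i) => [] [].
rewrite [(- _) ^+ (n - j)]exprNn [(- _) ^+ j]exprNn -[(-1) ^+ i]opprK -sign_eq.
by ring.
Qed.

Theorem theorem2p7 (n : nat) (hn : (0 < n)%N) :
  (forall j : nat, (j <= n)%N ->
     \sum_(0 <= k < n.+1) eulerian_coef n k j = (n`!)%:Z) /\
  (forall j k : nat, (j <= n)%N -> (k <= n)%N ->
     eulerian_coef n k j = eulerian_coef n (n - k)%N (n - j)%N).
Proof. by split=> [j|j k]; [apply: sum_eulerian_coef | apply: eulerian_coef_sym]. Qed.
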